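(* Let $ABC$ be a right triangle in the Euclidean plane with right angle at $B$, and let $H$ be the point where the incircle of $ABC$ is tangent to the hypotenuse $AC$. Then the area of $ABC$ is equal to the area of the rectangle with sides $s=|AH|$ and $t=|CH|$, i.e. the area of $ABC$ equals $s\,t$. *)

(* Defs.v *)
From mathcomp Require Import all_boot all_order all_algebra.
From mathcomp Require Import all_classical all_reals all_analysis.
Set Implicit Arguments.
Unset Strict Implicit.
Unset Printing Implicit Defensive.
Import Order.TTheory GRing.Theory Num.Theory.
Local Open Scope ring_scope.
Local Open Scope classical_set_scope.

(* The plane is R * R. The library's norm on a product is the sup norm, so the
   Euclidean distance is defined explicitly. *)
Definition dot (R : realType) (u v : R * R) : R := u.1 * v.1 + u.2 * v.2.

Definition distance (R : realType) (p q : R * R) : R :=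
  Num.sqrt (dot (q - p) (q - p)).

Definition line (R : realType) (p q : R * R) : set (R * R) :=
  [set x | exists k : R, x = p + k *: (q - p)].

Definition segment (R : realType) (p q : R * R) : set (R * R) :=
  [set x | exists k : R, 0 <= k <= 1 /\ x = p + k *: (q - p)].

Definition circle (R : realType) (c : R * R) (r : R) : set (R * R) :=
  [set x | distance c x = r].

(* The closed triangular region, including degenerate ones. *)
Definition triangle (R : realType) (A B C : R * R) : set (R * R) :=
  [set x | exists a b c : R,
     [/\ 0 <= a, 0 <= b, 0 <= c, a + b + c = 1
       & x = a *: A + b *: B + c *: C]].

Definition rectangle (R : realType) (s t : R) : set (R * R) :=
  `[0, s] `*` `[0, t].

Definition area (R : realType) (S : set (R * R)) : \bar R :=
  (lebesgue_measure \x lebesgue_measure)%E S.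

(* The vertices are required to be distinct, so that the angle exists; a right
   angle at B then makes A, B, C non-collinear. *)
Definition right_triangle_at (R : realType) (A B C : R * R) : Prop :=
  [/\ A != B, C != B & dot (A - B) (C - B) = 0].

Definition tangent_at (R : realType) (c : R * R) (r : R) (X Y P : R * R) : Prop :=
  circle c r `&` line X Y = [set P].

Definition tangent_to_side (R : realType) (c : R * R) (r : R) (X Y : R * R) : Prop :=
  exists2 P, segment X Y P & tangent_at c r X Y P.

(* Tangency points must lie on the sides themselves: this is what separates the
   incircle from the excircles, which are tangent to the three side lines. *)
Definition is_incircle (R : realType) (A B C c : R * R) (r : R) : Prop :=
  [/\ 0 < r, tangent_to_side c r A B, tangent_to_side c r B C
    & tangent_to_side c r A C].

(* Main.v *)
(* The tangent lengths from [A], [B], [C] to the incircle are [s], [x], [t], so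
   the sides are [s + x], [x + t], [s + t]. Pythagoras reads
   [x * (s + t) + x ^ 2 = s * t], and therefore half the product of the legs is
   [(s * t + x * (s + t) + x ^ 2) / 2 = s * t].
   The measure of a triangle in arbitrary position is found by integrating the
   lengths of its vertical sections, which are affine in the abscissa on either
   side of the middle vertex. *)

Require Import Defs.
From mathcomp Require Import all_boot all_order all_algebra.
From mathcomp Require Import all_classical all_reals all_analysis.
From mathcomp Require Import measurable_realfun ring lra.
Import Order.TTheory GRing.Theory Num.Theory.
Import numFieldNormedType.Exports.
Local Open Scope ring_scope.
Local Open Scope classical_set_scope.
Set Implicit Arguments.
Unset Strict Implicit.

(** * Vectors, distances and segments in the plane *)

Definition cross (R : realType) (u v : R * R) : R := u.1 * v.2 - u.2 * v.1.

(** Lagrange's identity in the plane. Here [cross] is the determinant, twice a signed triangle area;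
    for orthogonal vectors it becomes, up to sign, the product of the lengths. *)
Lemma cross_sq_dot_sq (R : realType) (u v : R * R) :
  cross u v ^+ 2 + dot u v ^+ 2 = dot u u * dot v v.
Proof. rewrite /cross /dot; ring. Qed.

(** A single multirule passes to coordinates, where vector identities become polynomial ones. *)
Lemma coordE (R : realType) :
  ((forall u v : R * R, (u + v)%R.1 = (u.1 + v.1)%R) *
   (forall u v : R * R, (u + v)%R.2 = (u.2 + v.2)%R) *
   (forall u : R * R, (- u)%R.1 = (- u.1)%R) *
   (forall u : R * R, (- u)%R.2 = (- u.2)%R) *
   (forall (k : R) (u : R * R), (k *: u)%R.1 = (k * u.1)%R) *
   (forall (k : R) (u : R * R), (k *: u)%R.2 = (k * u.2)%R))%type.
Proof. by []. Qed.

Lemma distance_ge0 (R : realType) (p q : R * R) : 0 <= distance p q.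
Proof. exact: sqrtr_ge0. Qed.

Lemma sqr_distance (R : realType) (p q : R * R) :
  distance p q ^+ 2 = dot (q - p) (q - p).
Proof. by rewrite sqr_sqrtr// addr_ge0 // -expr2 sqr_ge0. Qed.

Lemma distance_eq0 (R : realType) (p q : R * R) : distance p q = 0 -> p = q.
Proof.
move=> /(congr1 (fun x => x ^+ 2)); rewrite sqr_distance expr0n /dot !coordE -!expr2.
move: p q => [p1 p2] [q1 q2] /= /eqP.
rewrite paddr_eq0 ?sqr_ge0// !sqrf_eq0 !subr_eq0.
by move=> /andP[/eqP -> /eqP ->].
Qed.

Lemma distanceC (R : realType) (p q : R * R) : distance p q = distance q p.
Proof. by rewrite /distance /dot !coordE; congr (Num.sqrt _); ring. Qed.

Lemma distance_segment (R : realType) (X Y P : R * R) :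
  segment X Y P -> distance X P + distance P Y = distance X Y.
Proof.
move=> [k [/andP[k0 k1] ->]]; set d := distance X Y.
have d0 : 0 <= d by exact: distance_ge0.
(* Both sides are nonnegative, so comparing squares suffices and removes the square roots. *)
have -> : distance X (X + k *: (Y - X)) = k * d.
  apply/eqP; rewrite -(eqrXn2 (n:=2)) ?mulr_ge0 ?distance_ge0//.
  by rewrite exprMn !sqr_distance /dot !coordE; apply/eqP; ring.
have -> : distance (X + k *: (Y - X)) Y = (1 - k) * d.
  apply/eqP; rewrite -(eqrXn2 (n:=2)) ?mulr_ge0 ?distance_ge0 ?subr_ge0//.
  by rewrite exprMn !sqr_distance /dot !coordE; apply/eqP; ring.
ring.
Qed.

(** * Tangents to a circle *)

(* The reflection of [P] in the foot of the perpendicular from [c] is another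
   common point of the line and the circle, so it must be [P] itself. *)
Lemma tangent_orthogonal (R : realType) (c : R * R) (r : R) (X Y P : R * R) :
  X != Y -> tangent_at c r X Y P -> dot (P - c) (Y - X) = 0.
Proof.
move=> XY tP; set u := Y - X.
have u0 : dot u u != 0.
  apply: contraNneq XY => u0; apply/eqP/distance_eq0.
  by rewrite /distance u0 sqrtr0.
have [/= dP [k Pk]] : (circle c r `&` line X Y) P by rewrite tP.
set e := dot (P - c) u.
pose Q := P - (2 * (e / dot u u)) *: u.
have : (circle c r `&` line X Y) Q.
  split; last first.
    exists (k - 2 * (e / dot u u)).
    by rewrite /Q {1}Pk scalerBl addrA.
  rewrite /circle /= -dP /distance; congr Num.sqrt.
  rewrite /Q; move: u0; rewrite /e; move: (P) (c) (u) => [p1 p2] [c1 c2] [u1 u2].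
  by rewrite /dot !coordE => u0; field.
rewrite tP /= => /(congr1 (fun Z => dot (P - Z) u)).
rewrite subrr /Q subKr.
have -> : dot ((2 * (e / dot u u)) *: u) u = 2 * e.
  move: u0; rewrite /dot !coordE; set d := (_ + _) => u0.
  rewrite -!mulrA -!mulrDr -/d; field; exact: u0.
by rewrite /dot !coordE => h; lra.
Qed.

(** Pythagoras in the triangle [X P c], right-angled at [P]. The right-hand side is the power of [X]
    with respect to the circle: it is the same for every tangent through [X]. *)
Lemma sqr_tangent_length (R : realType) (c : R * R) (r : R) (X Y P : R * R) :
  X != Y -> tangent_at c r X Y P ->
  distance X P ^+ 2 = distance X c ^+ 2 - r ^+ 2.
Proof.
move=> XY tP; have orth := tangent_orthogonal XY tP.
have [/= dP [k Pk]] : (circle c r `&` line X Y) P by rewrite tP.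
rewrite -dP !sqr_distance.
have -> : dot (P - X) (P - X) = dot (c - X) (c - X) - dot (P - c) (P - c)
    + 2 * dot (P - c) (P - X) by rewrite /dot !coordE; ring.
have -> : dot (P - c) (P - X) = k * dot (P - c) (Y - X).
  by rewrite {2}Pk /dot !coordE; ring.
by rewrite orth !mulr0 addr0.
Qed.

Lemma tangent_length_eq (R : realType) (c : R * R) (r : R) (X Y Z P Q : R * R) :
  X != Y -> X != Z -> tangent_at c r X Y P -> tangent_at c r X Z Q ->
  distance X P = distance X Q.
Proof.
move=> XY XZ tP tQ; apply/eqP; rewrite -(eqrXn2 (n:=2)) ?distance_ge0//.
by rewrite (sqr_tangent_length XY tP) (sqr_tangent_length XZ tQ).
Qed.

Lemma tangent_atC (R : realType) (c : R * R) (r : R) (X Y P : R * R) :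
  tangent_at c r X Y P -> tangent_at c r Y X P.
Proof.
rewrite /tangent_at => <-; congr (_ `&` _); apply/seteqP.
split=> x [k ->]; exists (1 - k);
  by apply: injective_projections; rewrite !coordE; ring.
Qed.

(** * Area of a triangle by vertical sections *)

Lemma triangle_swap12 (R : realType) (A B C : R * R) :
  triangle A B C = triangle B A C.
Proof.
by apply/seteqP; split=> x [a [b [c [? ? ? E ->]]]]; exists b, a, c;
  split; rewrite // -?E 1?[b + a]addrC// [b *: _ + _]addrC.
Qed.

Lemma triangle_swap23 (R : realType) (A B C : R * R) :
  triangle A B C = triangle A C B.
Proof.
by apply/seteqP; split=> x [a [b [c [? ? ? E ->]]]]; exists a, c, b;
  split; rewrite // -?E addrAC.
Qed.

Lemma lebesgue_measure_cc (R : realType) (a b : R) : a <= b ->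
  lebesgue_measure `[a, b] = (b - a)%:E.
Proof.
move=> ab; rewrite lebesgue_measure_itv/= lte_fin.
by case: ltgtP ab => // -> _; rewrite subrr.
Qed.

Lemma area_rectangle (R : realType) (s t : R) : 0 <= s -> 0 <= t ->
  area (rectangle s t) = (s * t)%:E.
Proof.
move=> s0 t0; rewrite /area /rectangle product_measure1E//.
transitivity (s%:E * t%:E)%E => //; congr (_ * _)%E.
- by rewrite -[s in RHS]subr0; exact: lebesgue_measure_cc.
- by rewrite -[t in RHS]subr0; exact: lebesgue_measure_cc.
Qed.

(** The two ends of a vertical section may come in either order, hence the absolute value. *)
Lemma lebesgue_measure_segment (R : realType) (u v : R) :
  lebesgue_measure [set y | exists k : R, 0 <= k <= 1 /\ y = u + k * (v - u)] =
  `|v - u|%:E.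
Proof.
wlog uv : u v / u <= v => [hwlog|].
  have [/hwlog//|/ltW vu] := leP u v.
  rewrite distrC -(hwlog _ _ vu); congr (lebesgue_measure _).
  apply/seteqP; split=> y [k [/andP[k0 k1] ->]]; exists (1 - k);
    by (split; [apply/andP; split; lra|ring]).
rewrite ger0_norm ?subr_ge0// -lebesgue_measure_cc//.
congr (lebesgue_measure _); apply/seteqP; split=> y /=.
  by move=> [k [/andP[k0 k1] ->]]; rewrite in_itv/=; apply/andP; split; nra.
rewrite in_itv/= => /andP[uy yv].
have [uv'|] := eqVneq u v.
  by exists 0; split; [rewrite lexx ler01|rewrite -uv' in yv; lra].
rewrite -subr_eq0 => vu0; exists ((y - u) / (v - u)).
have vu : 0 < v - u by rewrite lt_neqAle subr_ge0 uv andbT eq_sym -oppr_eq0 opprB.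
split; last by field; lra.
by rewrite divr_ge0 ?subr_ge0//= ler_pdivrMr// mul1r lerD2r.
Qed.

(* Only the apex [P] lies on the other side of the vertical line at abscissa
   [x], so that line meets the two sides [PQ] and [PS], at ratios
   [(x - P.1) / (Q.1 - P.1)] and [(x - P.1) / (S.1 - P.1)]. *)
Lemma triangle_xsection (R : realType) (P Q S : R * R) (x : R) :
  0 < (x - P.1) / (Q.1 - P.1) <= 1 -> 0 < (x - P.1) / (S.1 - P.1) <= 1 ->
  lebesgue_measure (xsection (triangle P Q S) x) =
  (`|x - P.1| * (`|cross (Q - P) (S - P)| /
     (`|Q.1 - P.1| * `|S.1 - P.1|)))%:E.
Proof.
set q := Q.1 - P.1; set s := S.1 - P.1; set d := x - P.1.
move=> /andP[u0 u1] /andP[v0 v1].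
have q0 : q != 0 by apply: contraTneq u0 => ->; rewrite invr0 mulr0 ltxx.
have s0 : s != 0 by apply: contraTneq v0 => ->; rewrite invr0 mulr0 ltxx.
have d0 : d != 0 by apply: contraTneq v0 => ->; rewrite mul0r ltxx.
(* [u] and [v] are the ordinates where the vertical line meets [PQ] and [PS]. *)
pose u := P.2 + d / q * (Q.2 - P.2).
pose v := P.2 + d / s * (S.2 - P.2).
have -> : `|d| * (`|cross (Q - P) (S - P)| / (`|q| * `|s|)) = `|v - u|.
  rewrite -normrM -normfV -!normrM; congr `|_|.
  by rewrite /u /v /cross !coordE -/q -/s; field; rewrite q0.
rewrite -lebesgue_measure_segment; congr (lebesgue_measure _).
apply/seteqP; split=> y.
  move=> /xsectionP [a [b [c [a0 b0 c0 abc xy]]]].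
  have xE : x = a * P.1 + b * Q.1 + c * S.1 := congr1 fst xy.
  have yE : y = a * P.2 + b * Q.2 + c * S.2 := congr1 snd xy.
  have dE : d = b * q + c * s.
    by rewrite /d xE /q /s (_ : a = 1 - b - c); [ring|lra].
  have cE : c * s / d = c / (d / s) by field; rewrite s0.
  have bE : 1 - c * s / d = b / (d / q) by rewrite dE; field; rewrite -dE d0 q0.
  (* By [dE] the horizontal offset [d] splits as [b * q + c * s]; the share of [S] in it is the
     position between [u] and [v]. *)
  exists (c * s / d); split.
    have cd0 := divr_ge0 c0 (ltW v0); have bd0 := divr_ge0 b0 (ltW u0).
    by rewrite -cE in cd0; rewrite -bE subr_ge0 in bd0; apply/andP.
  have -> : y = P.2 + b * (Q.2 - P.2) + c * (S.2 - P.2).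
    by rewrite yE (_ : a = 1 - b - c); [ring|lra].
  have -> : v - u = d / s * (S.2 - P.2) - d / q * (Q.2 - P.2).
    by rewrite /u /v; ring.
  have -> : b = (1 - c * s / d) * (d / q) by rewrite bE; field; rewrite q0.
  by rewrite /u; field; rewrite q0 s0.
move=> [k [/andP[k0 k1] ->]]; apply/xsectionP.
(* Mixture, in proportions [1 - k] and [k], of the barycentric weights of the crossing points:
   [d / q] on [Q] for the first, [d / s] on [S] for the second, the rest on [P]. *)
exists (1 - (1 - k) * (d / q) - k * (d / s)), ((1 - k) * (d / q)), (k * (d / s)).
split; [|by rewrite mulr_ge0 ?subr_ge0// ltW|by rewrite mulr_ge0// ltW|ring|].
- by move: u0 u1 v0 v1; set z := d / q; set w := d / s => *; nra.
- apply: injective_projections; rewrite !coordE /=.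
    rewrite (_ : x = P.1 + d); last by rewrite /d; ring.
    rewrite (_ : Q.1 = P.1 + q); last by rewrite /q; ring.
    rewrite (_ : S.1 = P.1 + s); last by rewrite /s; ring.
    by field; rewrite s0 q0.
  by rewrite /u /v; ring.
Qed.

(** By Cramer's rule the barycentric coordinates of [x] are these [cross] values divided by [D].
    Multiplying by [D] instead keeps the signs and leaves polynomial inequalities, from which
    measurability follows. *)
Lemma triangle_half_planes (R : realType) (A B C : R * R) :
  let D := cross (B - A) (C - A) in D != 0 ->
  triangle A B C = [set x | [/\ 0 <= cross (B - x) (C - x) * D,
    0 <= cross (C - x) (A - x) * D & 0 <= cross (A - x) (B - x) * D]].
Proof.
move=> D D0; apply/seteqP; split=> x /=.
  move=> [a [b [c [a0 b0 c0 abc xE]]]].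
  have -> : cross (B - x) (C - x) = a * D.
    by rewrite xE /D /cross !coordE (_ : a = 1 - b - c); [ring|lra].
  have -> : cross (C - x) (A - x) = b * D.
    by rewrite xE /D /cross !coordE (_ : a = 1 - b - c); [ring|lra].
  have -> : cross (A - x) (B - x) = c * D.
    by rewrite xE /D /cross !coordE (_ : a = 1 - b - c); [ring|lra].
  by have DD := sqr_ge0 D; rewrite -!mulrA -expr2; split; apply: mulr_ge0.
have E z : 0 <= z * D -> 0 <= z / D.
  move=> h; rewrite (_ : z / D = (z * D) * (D^-1 ^+ 2)); last by field.
  by rewrite mulr_ge0// sqr_ge0.
move=> [/E a0 /E b0 /E c0]; do 3 eexists; split; [exact: a0|exact: b0|exact: c0| |].
- by move: D0; rewrite /D /cross !coordE => D0; field.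
- by apply: injective_projections; move: D0; rewrite /D /cross !coordE => D0;
    field.
Qed.

Lemma measurable_triangle (R : realType) (A B C : R * R) :
  cross (B - A) (C - A) != 0 -> measurable (triangle A B C).
Proof.
move=> D0; rewrite triangle_half_planes//; set D := cross (B - A) _.
have mh (X Y : R * R) :
    measurable [set x : R * R | 0 <= cross (X - x) (Y - x) * D].
  rewrite -[X in measurable X]setTI; apply: measurable_fun_le => //.
  by apply: measurable_funM => //; apply: measurable_funB;
    apply: measurable_funM; apply: measurable_funB.
rewrite (_ : [set x | _] = [set x : R * R | 0 <= cross (B - x) (C - x) * D] `&`
  ([set x | 0 <= cross (C - x) (A - x) * D] `&`
   [set x | 0 <= cross (A - x) (B - x) * D])).
  by apply: measurableI => //; exact: measurableI.
by apply/seteqP; split=> x /= [] => [? ? ?|? []].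
Qed.

Lemma integral_affine (R : realType) (a b p c : R) : a <= b ->
  (\int[lebesgue_measure]_(x in `[a, b]) ((x - p) * c)%:E =
   (((b - p) ^+ 2 - (a - p) ^+ 2) * c / 2)%:E)%E.
Proof.
rewrite le_eqVlt => /predU1P[->|ab].
  by rewrite set_itv1 integral_set1 subrr mul0r mul0r.
pose F (x : R) := (x - p) ^+ 2 * c / 2.
have dF (x : R) : is_derive x 1 F ((x - p) * c).
  by rewrite /F; apply: is_derive_eq; rewrite /GRing.scale/=; field.
rewrite (@continuous_FTC2 _ _ F)//.
- by rewrite -EFinB /F; congr EFin; ring.
- apply: continuous_subspaceT => x.
  by apply: cvgM; [apply: cvgB; [exact: cvg_id|exact: cvg_cst]|exact: cvg_cst].
- have cF (x : R) : F y @[y --> x] --> F x.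
    by apply/differentiable_continuous/derivable1_diffP; case: (dF x).
  split=> [x _||]; [by case: (dF x)| |].
  + by apply: cvg_at_right_filter; exact: cF.
  + by apply: cvg_at_left_filter; exact: cF.
- by move=> x _; rewrite derive1E; apply: derive_val.
Qed.

(* [e] is the sign of [x - P.1], constant on [`]a, b[]. *)
Lemma integral_xsection_triangle (R : realType) (P Q S : R * R) (a b e : R) :
  cross (Q - P) (S - P) != 0 -> a <= b ->
  (forall x, a < x -> x < b -> [/\ `|x - P.1| = e * (x - P.1),
     0 < (x - P.1) / (Q.1 - P.1) <= 1 & 0 < (x - P.1) / (S.1 - P.1) <= 1]) ->
  (\int[lebesgue_measure]_(x in `[a, b])
     lebesgue_measure (xsection (triangle P Q S) x) =
   (((b - P.1) ^+ 2 - (a - P.1) ^+ 2) * (e *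
     (`|cross (Q - P) (S - P)| / (`|Q.1 - P.1| * `|S.1 - P.1|))) / 2)%:E)%E.
Proof.
move=> D0 ab ratio; set c := _ / (_ * _).
have mf : measurable_fun setT
    (fun x => lebesgue_measure (xsection (triangle P Q S) x)).
  by apply: measurable_fun_xsection; exact: measurable_triangle.
rewrite -integral_affine//.
have mg : measurable_fun setT (fun x : R => ((x - P.1) * (e * c))%:E).
  apply/measurable_EFinP; apply: measurable_funM => //.
  exact: measurable_funB.
rewrite integral_itv_bndoo; last exact: measurable_funTS.
rewrite [RHS]integral_itv_bndoo; last exact: measurable_funTS.
apply: eq_integral => x; rewrite inE/= in_itv/= => /andP[ax xb].
have [xE u v] := ratio x ax xb.
by rewrite triangle_xsection// xE -/c; congr EFin; ring.
Qed.

(** With the vertices sorted by abscissa, the apex is [A] to the left of [B] and [C] to its right.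
    The two integrals are proportional, with the same factor, to [B.1 - A.1] and [C.1 - B.1], whose
    sum cancels the remaining [C.1 - A.1]. *)
Lemma area_triangle (R : realType) (A B C : R * R) :
  cross (B - A) (C - A) != 0 ->
  area (triangle A B C) = (`|cross (B - A) (C - A)| / 2)%:E.
Proof.
wlog AB : A B C / A.1 <= B.1 => [hwlog D0|].
  have [AB|/ltW BA] := leP A.1 B.1; first exact: hwlog.
  have E : cross (A - B) (C - B) = - cross (B - A) (C - A).
    by rewrite /cross !coordE; ring.
  by rewrite triangle_swap12 hwlog// E ?normrN// oppr_eq0.
wlog AC : A B C AB / A.1 <= C.1 => [hwlog D0|].
  have [AC|/ltW CA] := leP A.1 C.1; first exact: hwlog.
  have E : cross (A - C) (B - C) = cross (B - A) (C - A).
    by rewrite /cross !coordE; ring.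
  by rewrite triangle_swap23 triangle_swap12 hwlog// ?E// (le_trans CA).
wlog BC : A B C AB AC / B.1 <= C.1 => [hwlog D0|D0].
  have [BC|/ltW CB] := leP B.1 C.1; first exact: hwlog.
  have E : cross (C - A) (B - A) = - cross (B - A) (C - A).
    by rewrite /cross !coordE; ring.
  by rewrite triangle_swap23 hwlog// E ?normrN// oppr_eq0.
(* Otherwise all three abscissas agree and the vertices are collinear. *)
have AC' : A.1 < C.1.
  rewrite lt_neqAle AC andbT; apply: contraNneq D0 => ACE.
  by rewrite /cross !coordE -ACE (_ : B.1 = A.1); [apply/eqP; ring|lra].
pose f x := lebesgue_measure (xsection (triangle A B C) x).
have mf : measurable_fun setT f.
  by apply: measurable_fun_xsection; exact: measurable_triangle.
(* Sections at other abscissas are empty, since [x] is a convex combination of those of the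
   vertices. *)
transitivity (\int[lebesgue_measure]_(x in `[A.1, C.1]) f x)%E.
  rewrite /area /product_measure1 [RHS]integral_mkcond.
  apply: eq_integral => x _ /=; rewrite patchE; case: ifPn => //.
  rewrite notin_setE/= in_itv/= => /negP xAC.
  rewrite (_ : xsection _ _ = set0) ?measure0//; apply/seteqP; split=> // y.
  move=> /xsectionP [a [b [c [a0 b0 c0 abc xy]]]]; apply: (negP xAC).
  have -> : x = a * A.1 + b * B.1 + c * C.1 := congr1 fst xy.
  by rewrite (_ : a = 1 - b - c); [apply/andP; split; nra|lra].
rewrite (_ : `[A.1, C.1] = `[A.1, B.1] `|` `]B.1, C.1]); last first.
  by rewrite -itv_bndbnd_setU// bnd_simp.
rewrite ge0_integral_setU//=; last 2 first.
- exact: measurable_funTS.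
- apply/disj_setPLR => x /=; rewrite !in_itv/= => /andP[_ xB].
  by apply/negP; rewrite ltNge xB.
rewrite [X in (_ + X)%E](_ : _ = \int[lebesgue_measure]_(x in `[B.1, C.1]) f x)%E;
  last by rewrite integral_itv_obnd_cbnd//; exact: measurable_funTS.
rewrite (@integral_xsection_triangle _ A B C _ _ 1)//; last first.
  move=> x Ax xB; rewrite mul1r ger0_norm ?subr_ge0 ?(ltW Ax)//; split=> //.
    by rewrite divr_gt0 ?ler_pdivrMr//=; lra.
  by rewrite divr_gt0 ?ler_pdivrMr//=; lra.
have E : cross (B - C) (A - C) = - cross (B - A) (C - A).
  by rewrite /cross !coordE; ring.
(* Three transpositions turn [A B C] into [C B A], putting the apex of the right part first. *)
rewrite /f triangle_swap12 triangle_swap23 triangle_swap12.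
rewrite (@integral_xsection_triangle _ C B A _ _ (-1))//; last first.
  move=> x Bx xC; rewrite mulN1r ler0_norm ?subr_le0 ?(ltW xC)//; split=> //.
    by rewrite -mulrNN -invrN !opprB divr_gt0 ?ler_pdivrMr//=; lra.
  by rewrite -mulrNN -invrN !opprB divr_gt0 ?ler_pdivrMr//=; lra.
  by rewrite E oppr_eq0.
rewrite E normrN -EFinD; congr EFin.
set D : R := `|cross _ _|.
rewrite !subrr expr0n/= subr0 sub0r mul1r.
rewrite [`|A.1 - C.1|]distrC [`|B.1 - C.1|]distrC !ger0_norm ?subr_ge0//.
(* The convention that [0] has inverse [0] covers the case where [B] shares its abscissa with [A] or
   [C]. *)
have sqr_div (z : R) : z ^+ 2 / z = z.
  by have [->|z0] := eqVneq z 0; [rewrite invr0 mulr0|rewrite expr2 mulfK].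
rewrite !invfM.
transitivity (((B.1 - A.1) ^+ 2 / (B.1 - A.1) + (C.1 - B.1) ^+ 2 / (C.1 - B.1)) *
  (D / (C.1 - A.1) / 2)); first by ring.
by rewrite !sqr_div; field; rewrite subr_eq0 gt_eqF.
Qed.

(** * The right triangle and its incircle *)

Theorem theorem2 (R : realType) (A B C I H : R * R) (r s t : R)
    (right_at_B : right_triangle_at A B C)
    (incircle_I_r : is_incircle A B C I r)
    (touch_H : tangent_at I r A C H)
    (def_s : s = distance A H) (def_t : t = distance C H) :
  area (triangle A B C) = area (rectangle s t) /\
  area (triangle A B C) = (s * t)%:E.
Proof.
have [AB CB orth] := right_at_B.
have BA : B != A by rewrite eq_sym.
have BC : B != C by rewrite eq_sym.
have pythagoras :
    distance A B ^+ 2 + distance C B ^+ 2 = distance A C ^+ 2.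
  have -> : distance A C ^+ 2 =
      distance A B ^+ 2 + distance C B ^+ 2 - 2 * dot (A - B) (C - B).
    by rewrite !sqr_distance /dot !coordE; ring.
  by rewrite orth mulr0 subr0.
have AC : A != C.
  apply: contraNneq AB => ACE; move: orth; rewrite -ACE => orth.
  by apply/eqP/esym/distance_eq0; rewrite /distance orth sqrtr0.
have CA : C != A by rewrite eq_sym.
have [_ [P segP tP] [Q segQ tQ] [H' segH tH']] := incircle_I_r.
(* Both are the only common point of the circle and the line [AC]; hence [H] lies on the side
   itself. *)
have HE : H' = H.
  have : [set H'] H' by [].
  by rewrite -tH' touch_H.
rewrite HE in segH.
have xs : distance A P = s.
  by rewrite def_s; exact: tangent_length_eq AB AC tP touch_H.
have yt : distance C Q = t.
  rewrite def_t; apply: tangent_length_eq CB CA _ _; first exact: tangent_atC tQ.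
  exact: tangent_atC touch_H.
set x := distance B P.
have Qx : distance B Q = x.
  by apply/esym; exact: tangent_length_eq BA BC (tangent_atC tP) tQ.
have ABE : distance A B = s + x.
  by rewrite -(distance_segment segP) xs [distance P B]distanceC.
have CBE : distance C B = x + t.
  by rewrite distanceC -(distance_segment segQ) Qx [distance Q C]distanceC yt.
have ACE : distance A C = s + t.
  by rewrite -(distance_segment segH) -def_s [distance H C]distanceC -def_t.
have stE : (s + x) * (x + t) / 2 = s * t.
  by move: pythagoras; rewrite ABE CBE ACE => h; lra.
(* Lagrange's identity with the right angle at [B]: twice the area is the product of the legs. *)
have crossE : `|cross (B - A) (C - A)| = (s + x) * (x + t).
  rewrite (_ : cross _ _ = cross (A - B) (C - B) * -1); last first.
    by rewrite /cross !coordE; ring.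
  rewrite mulrN1 normrN -ABE -CBE; apply/eqP.
  rewrite -(eqrXn2 (n:=2)) ?mulr_ge0 ?distance_ge0// real_normK ?num_real//.
  have := cross_sq_dot_sq (A - B) (C - B).
  rewrite orth expr0n addr0 => ->; rewrite exprMn.
  by rewrite [distance A B]distanceC [distance C B]distanceC !sqr_distance.
have D0 : cross (B - A) (C - A) != 0.
  apply/eqP => D0; move: crossE; rewrite D0 normr0 -ABE -CBE => /esym/eqP.
  rewrite mulf_eq0 => /orP[] /eqP/distance_eq0 E.
    by rewrite E eqxx in AB.
  by rewrite E eqxx in CB.
have areaE : area (triangle A B C) = (s * t)%:E.
  by rewrite area_triangle// crossE stE.
by rewrite areaE area_rectangle// ?def_s ?def_t ?distance_ge0.
Qed.
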